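(* For every composition $\alpha$ of $n$, the map $f_\alpha:\mathrm{SYCT}(\alpha)\to\mathsf{W}_{\mathrm{SYCT}(\alpha)}$, sending $T$ to the word whose $i$th letter is the index of the column of $T$ containing $i$, is bijective.
   Context: A composition $\alpha=(\alpha_1,\dots,\alpha_k)$ of $n$ is a finite list of positive integers with sum $n$; $\ell(\alpha)=k$. The diagram $D(\alpha)$ is the left-justified array with $\alpha_i$ boxes in row $i$, rows numbered from bottom to top; box $(i,j)$ lies in column $i$ and row $j$, and $T_{i,j}$ is the entry of $T$ there. $c_i(\alpha)$ is the number of boxes in column $i$ and $\alpha_{\max}$ is the largest part of $\alpha$. $\mathrm{SYCT}(\alpha)$ is the set of standard Young composition tableaux of shape $\alpha$: fillings of $D(\alpha)$ with $1,\dots,n$ (each once), rows increasing from left to right, first column increasing from bottom to top, such that whenever $i<j$, $(k,j),(k+1,i)\in D(\alpha)$ and $T_{k,j}\le T_{k+1,i}$, then $(k+1,j)\in D(\alpha)$ and $T_{k+1,j}<T_{k+1,i}$. A lattice word is a word in positive integers in which every prefix contains, for each positive integer $i$, at least as many $i$'s as $(i+1)$'s. For a lattice word $w=w_1\cdots w_l$, let $p_{i,1}<\cdots<p_{i,r_i}$ be the positions of the letter $i$ in $w$. Define the word $\mathrm{rs}(w)=a_1\cdots a_l$ recursively: $a_{p_{1,k}}:=k$ for $1\le k\le r_1$; and for $i\ge2$ and $k=1,\dots,r_i$ (in this order, all values for $i-1$ already being determined), $a_{p_{i,k}}:=\max A_k$ with $$A_k=\{a_{p_{i-1,j}}\mid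 1\le j\le r_{i-1},\ p_{i-1,j}<p_{i,k}\}\setminus\{a_{p_{i,j}}\mid 1\le j\le k-1\}.$$ $\mathsf{W}_{\mathrm{SYCT}(\alpha)}$ is the set of words $w$ such that: $w$ is a lattice word; the letters of $w$ lie in $\{1,\dots,\alpha_{\max}\}$, and each letter $1\le i\le\alpha_{\max}$ appears exactly $c_i(\alpha)$ times in $w$; and each letter $1\le j\le\ell(\alpha)$ appears exactly $\alpha_j$ times in $\mathrm{rs}(w)$. *)

(* Defs.v *)
From mathcomp Require Import all_boot.
From mathcomp Require Import classical_sets functions.

Set Implicit Arguments.
Unset Strict Implicit.
Unset Printing Implicit Defensive.

Local Open Scope classical_set_scope.

Definition composition (n : nat) (alpha : seq nat) : Prop :=
  0 \notin alpha /\ sumn alpha = n.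

(* Parts, rows and columns are indexed from 1: [part alpha j] is alpha_j. *)
Definition part (alpha : seq nat) (j : nat) : nat := nth 0 alpha j.-1.

Definition max_part (alpha : seq nat) : nat := \max_(a <- alpha) a.

(* The pair (i, j) is the box in column i and row j, with row 1 at the
   bottom. *)
Definition diagram (alpha : seq nat) : seq (nat * nat) :=
  [seq (i, j) | j <- iota 1 (size alpha), i <- iota 1 (part alpha j)].

Definition column_count (alpha : seq nat) (i : nat) : nat :=
  count (fun b => b.1 == i) (diagram alpha).

Definition box (alpha : seq nat) : finType := seq_sub (diagram alpha).

Definition box_col (alpha : seq nat) (b : box alpha) : nat := (ssval b).1.
Definition box_row (alpha : seq nat) (b : box alpha) : nat := (ssval b).2.

Definition filling (alpha : seq nat) : Type := {ffun box alpha -> nat}.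

Definition SYCT (alpha : seq nat) : set (filling alpha) :=
  [set T |
    [/\ perm_eq (codom T) (iota 1 (sumn alpha)),
        forall b c : box alpha, box_row b = box_row c ->
          box_col b < box_col c -> T b < T c,
        forall b c : box alpha, box_col b = 1 -> box_col c = 1 ->
          box_row b < box_row c -> T b < T c
      & (* b = (k, j) and c = (k+1, i) with i < j; then d = (k+1, j). *)
        forall b c : box alpha, box_row c < box_row b ->
          box_col c = (box_col b).+1 -> T b <= T c ->
          exists d : box alpha,
            [/\ box_col d = (box_col b).+1, box_row d = box_row b
              & T d < T c]]].

Arguments SYCT : clear implicits.

Definition lattice_word (w : seq nat) : Prop :=
  (forall x, x \in w -> 0 < x) /\
  (forall u, prefix u w ->
     forall i, 0 < i -> count_mem i.+1 u <= count_mem i u).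

Definition positions (w : seq nat) (i : nat) : seq nat :=
  [seq p <- iota 0 (size w) | nth 0 w p == i].

(* [prev] lists the pairs (p_{i-1,j}, a_{p_{i-1,j}}) and [ps] the positions
   p_{i,1} < p_{i,2} < ...; the result lists a_{p_{i,1}}, a_{p_{i,2}}, ...
   The accumulator [used] holds the labels already given to the letter i, so
   that the maximum is that of A_k. It is 0 if A_k is empty, which does not
   happen for lattice words. *)
Definition rs_step (prev : seq (nat * nat)) (ps : seq nat) : seq nat :=
  foldl (fun used p =>
           rcons used (\max_(x <- prev | (x.1 < p) && (x.2 \notin used)) x.2))
        [::] ps.

(* The sequence a_{p_{i,1}}, ..., a_{p_{i,r_i}}. *)
Fixpoint rs_labels (w : seq nat) (i : nat) : seq nat :=
  match i with
  | 0 => [::]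
  | 1 => iota 1 (count_mem 1 w)
  | (_.+1 as h).+1 =>
      rs_step (zip (positions w h) (rs_labels w h)) (positions w h.+1)
  end.

Definition rs (w : seq nat) : seq nat :=
  [seq nth 0 (rs_labels w (nth 0 w p)) (index p (positions w (nth 0 w p)))
     | p <- iota 0 (size w)].

Definition W_SYCT (alpha : seq nat) : set (seq nat) :=
  [set w |
    [/\ lattice_word w,
        forall x, x \in w -> 1 <= x <= max_part alpha,
        forall i, 1 <= i <= max_part alpha ->
          count_mem i w = column_count alpha i
      & forall j, 1 <= j <= size alpha ->
          count_mem j (rs w) = part alpha j]].

(* The column of T containing the entry m (0 if m is not an entry of T). *)
Definition column_of (alpha : seq nat) (T : filling alpha) (m : nat) : nat :=
  if [pick b | T b == m] is Some b then box_col b else 0.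

Definition column_word (alpha : seq nat) (T : filling alpha) : seq nat :=
  [seq column_of T m | m <- iota 1 (sumn alpha)].

Arguments column_word : clear implicits.

(* Main.v *)
(* The word rs(w) recovers the rows: if w is the column word of T, then the
   letter of rs(w) at position m is the row of the entry m. For an entry of
   column i+1 its row is in A_k by its left neighbour, and a larger row in A_k
   would violate the triple condition. Hence T is determined by w. Conversely,
   for w in W_SYCT(alpha) the cells (w_p, a_p) are pairwise distinct, and each
   row of cells is left-justified since a label of the letter i+1 is a label of
   an earlier letter i, so they fill the diagram. The maximality of the labels
   is then exactly the triple condition. *)
Require Import Defs.
From mathcomp Require Import all_boot.
From mathcomp Require Import classical_sets functions.

Set Implicit Arguments.
Unset Strict Implicit.
Unset Printing Implicit Defensive.

(** * Maxima over sequences and initial segments of sorted sequences *)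

(** Used to see that the maximum of a nonempty A_k is the label of an actual position and not the
    default 0. *)
Lemma bigmax_seq_attained (T : eqType) (s : seq T) (P : pred T) (F : T -> nat) :
  has P s -> exists2 x, (x \in s) && P x & \max_(y <- s | P y) F y = F x.
Proof.
elim: s => //= a s IHs; rewrite big_cons; case: (boolP (P a)) => Pa /= hasP.
- have [/IHs[x /andP[xs Px] ->] | /hasPn noP] := boolP (has P s); last first.
    exists a; first by rewrite mem_head.
    rewrite big_seq_cond big_pred0 ?maxn0 // => x.
    by apply/negP => /andP[/noP/negP].
  case: leqP => _; first by exists x; rewrite ?inE ?xs ?orbT.
  by exists a; rewrite ?mem_head.
- by have [x /andP[xs Px] ->] := IHs hasP; exists x; rewrite ?inE ?xs ?orbT.
Qed.

(** The recursion stores the labels already given as an initial segment; this turns it into the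
    labels of the positions before [p]. *)
Lemma take_index_sorted (s : seq nat) (p : nat) :
  sorted ltn s -> p \in s -> take (index p s) s = [seq q <- s | q < p].
Proof.
elim: s => //= a s IHs a_s; rewrite inE eq_sym.
have lt_a: all (ltn a) s by apply: order_path_min a_s; apply: ltn_trans.
case: (eqVneq a p) => [<- _|_ /= ps].
  rewrite ltnn; apply/esym/eqP; rewrite -[_ == _]negbK -has_filter.
  by apply/hasPn => q /(allP lt_a) /=; rewrite -leqNgt => /ltnW.
by have /= -> := allP lt_a p ps; rewrite IHs ?(path_sorted a_s).
Qed.

(** * Positions of a letter in a word *)

Lemma positions_sorted (w : seq nat) (i : nat) : sorted ltn (positions w i).
Proof. exact/(sorted_filter ltn_trans)/iota_ltn_sorted. Qed.

Lemma positions_uniq (w : seq nat) (i : nat) : uniq (positions w i).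
Proof. exact/filter_uniq/iota_uniq. Qed.

Lemma size_positions (w : seq nat) (i : nat) :
  size (positions w i) = count_mem i w.
Proof.
by rewrite size_filter -{3}(mkseq_nth 0 w) /mkseq count_map.
Qed.

(* Out-of-range positions carry the default letter 0, hence the [i.+1]. *)
Lemma mem_positions (w : seq nat) (i p : nat) :
  (p \in positions w i.+1) = (nth 0 w p == i.+1).
Proof.
rewrite mem_filter mem_iota /= add0n andbC.
by case: ltnP => //= le_w; rewrite nth_default.
Qed.

Lemma mem_positions_lt (w : seq nat) (i k p : nat) :
  (p \in [seq q <- positions w i.+1 | q < k]) = (p < k) && (nth 0 w p == i.+1).
Proof. by rewrite -mem_positions mem_filter. Qed.

Lemma positions_lt_uniq (w : seq nat) (i k : nat) :
  uniq [seq q <- positions w i | q < k].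
Proof. exact/filter_uniq/positions_uniq. Qed.

(** Both sides are sizes of strictly increasing lists with the same members. This restates prefix
    counts through positions. *)
Lemma count_mem_take (w : seq nat) (i k : nat) :
  count_mem i.+1 (take k w) = size [seq p <- positions w i.+1 | p < k].
Proof.
rewrite -size_positions; congr size.
apply: (irr_sorted_eq ltn_trans ltnn).
- exact: positions_sorted.
- exact/(sorted_filter ltn_trans)/positions_sorted.
move=> p; rewrite mem_positions mem_positions_lt.
case: (ltnP p k) => [lt_pk | le_kp] /=; first by rewrite nth_take.
by rewrite nth_default // size_take_min (leq_trans (geq_minl _ _)).
Qed.

(** * The recursion for [rs] in terms of positions *)

Lemma size_rs_step (prev : seq (nat * nat)) (ps : seq nat) :
  size (rs_step prev ps) = size ps.
Proof.
by elim/last_ind: ps => // ps p IH; rewrite /rs_step foldl_rcons !size_rcons -IH.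
Qed.

(** The fold only appends, so the accumulator seen at step [k] is the initial segment of length [k]
    of the final list. *)
Lemma nth_rs_step (prev : seq (nat * nat)) (ps : seq nat) (k : nat) :
  k < size ps ->
  nth 0 (rs_step prev ps) k =
    \max_(x <- prev | (x.1 < nth 0 ps k)
                      && (x.2 \notin take k (rs_step prev ps))) x.2.
Proof.
elim/last_ind: ps => // ps p IH; rewrite size_rcons ltnS leq_eqVlt.
have -> : rs_step prev (rcons ps p) = rcons (rs_step prev ps)
   (\max_(x <- prev | (x.1 < p) && (x.2 \notin rs_step prev ps)) x.2).
  by rewrite /rs_step foldl_rcons.
rewrite !nth_rcons size_rs_step -cats1.
case: ltngtP => //= [lt_k _ | -> _].
- rewrite IH // takel_cat // size_rs_step; exact: ltnW.
- by rewrite take_size_cat ?size_rs_step.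
Qed.

(** The letter a_p of [rs w], with positions counted from 0 and the value 0 beyond the end of
    [w]. *)
Definition label (w : seq nat) (p : nat) : nat := nth 0 (rs w) p.

Lemma size_rs (w : seq nat) : size (rs w) = size w.
Proof. by rewrite size_map size_iota. Qed.

Lemma size_rs_labels (w : seq nat) (i : nat) :
  size (rs_labels w i.+1) = size (positions w i.+1).
Proof.
by case: i => [|i] /=; rewrite ?size_rs_step // size_iota size_positions.
Qed.

Lemma labelE (w : seq nat) (i p : nat) : nth 0 w p = i.+1 ->
  label w p = nth 0 (rs_labels w i.+1) (index p (positions w i.+1)).
Proof.
move=> wp; have lt_p : p < size w.
  by case: ltnP => // le_wp; rewrite nth_default in wp.
by rewrite /label /rs (nth_map 0) ?size_iota // nth_iota // add0n wp.
Qed.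

Lemma rs_labelsE (w : seq nat) (i : nat) :
  rs_labels w i.+1 = [seq label w p | p <- positions w i.+1].
Proof.
apply: (@eq_from_nth _ 0); first by rewrite size_map size_rs_labels.
move=> k; rewrite size_rs_labels => lt_k; rewrite (nth_map 0) // (@labelE w i).
  by rewrite index_uniq // positions_uniq.
by apply/eqP; rewrite -mem_positions mem_nth.
Qed.

Lemma label1 (w : seq nat) (p : nat) : nth 0 w p = 1 ->
  label w p = (size [seq q <- positions w 1 | q < p]).+1.
Proof.
move=> wp; have p_in : p \in positions w 1 by rewrite mem_positions wp.
rewrite (labelE wp) /= nth_iota; last by rewrite -size_positions index_mem.
rewrite add1n -take_index_sorted ?positions_sorted // size_takel //.
exact: index_size.
Qed.

(** The maximum ranges over A_k: the labels of earlier letters [i.+1], without those taken by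
    earlier letters [i.+2]. *)
Lemma labelS (w : seq nat) (i p : nat) : nth 0 w p = i.+2 ->
  label w p =
    \max_(q <- positions w i.+1 |
           (q < p) && (label w q \notin
             [seq label w r | r <- [seq r <- positions w i.+2 | r < p]]))
      label w q.
Proof.
move=> wp; have p_in : p \in positions w i.+2 by rewrite mem_positions wp.
rewrite (labelE wp).
have -> : rs_labels w i.+2 =
    rs_step (zip (positions w i.+1) (rs_labels w i.+1)) (positions w i.+2).
  by [].
rewrite nth_rs_step ?index_mem // nth_index //.
rewrite -/(rs_labels w i.+2) [rs_labels w i.+2]rs_labelsE -map_take.
rewrite take_index_sorted ?positions_sorted // rs_labelsE.
(* Seen as the image of an identity map, the positions zip with their labels into a single map. *)
by rewrite -{1}[positions w i.+1]map_id zip_map big_map.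
Qed.

(** * Labels of lattice words: injectivity, maximality, inheritance *)

Lemma lattice_count (w : seq nat) (i k : nat) : lattice_word w ->
  size [seq p <- positions w i.+2 | p < k]
    <= size [seq p <- positions w i.+1 | p < k].
Proof.
by case=> _ lat; rewrite -!count_mem_take lat // prefix_take.
Qed.

(** The label of a letter 1 is one more than the number of earlier 1's, so it strictly increases
    with the position. *)
Lemma label1_inj (w : seq nat) :
  {in positions w 1 &, injective (label w)}.
Proof.
have mono p q : nth 0 w p = 1 -> nth 0 w q = 1 -> p < q -> label w p < label w q.
  move=> wp wq lt_pq; rewrite !label1 // ltnS.
  apply: (@uniq_leq_size _ (p :: [seq r <- positions w 1 | r < p])).
    by rewrite /= mem_positions_lt ltnn positions_lt_uniq.
  move=> r; rewrite inE !mem_positions_lt.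
  case: eqVneq => [->|_ /= /andP[lt_rp ->]]; first by rewrite lt_pq wp.
  by rewrite (ltn_trans lt_rp).
move=> p q; rewrite !mem_positions => /eqP wp /eqP wq e.
by case: (ltngtP p q) => // /mono; rewrite wp wq e ltnn => /(_ erefl erefl).
Qed.

(* The set A_k is never empty: the lattice condition up to the position [p]
   gives more labels of the preceding letter than labels already used. *)
Lemma label_prev (w : seq nat) (i p : nat) : lattice_word w ->
    {in positions w i.+1 &, injective (label w)} -> nth 0 w p = i.+2 ->
  (exists q, [/\ q < p, nth 0 w q = i.+1 & label w q = label w p]) /\
  (forall r, r < p -> nth 0 w r = i.+2 -> label w r <> label w p).
Proof.
move=> lat inj wp; rewrite (labelS wp).
set prev := positions w i.+1; set cur := [seq r <- positions w i.+2 | r < p].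
set P := fun q => (q < p) && (label w q \notin [seq label w r | r <- cur]).
have /bigmax_seq_attained-/(_ (label w)) : has P prev.
  apply/negPn/negP => /hasPn noP.
  have : size [seq q <- prev | q < p] <= size cur.
    rewrite -(size_map (label w)) -[leqRHS](size_map (label w)).
    apply: uniq_leq_size.
      rewrite map_inj_in_uniq ?positions_lt_uniq // => q r.
      rewrite !mem_positions_lt -!mem_positions.
      by move=> /andP[_ ?] /andP[_ ?]; apply: inj.
    move=> _ /mapP[q + ->]; rewrite mem_positions_lt -mem_positions.
    move=> /andP[lt_qp /noP].
    by rewrite /P lt_qp negbK.
  apply/negP; rewrite -ltnNge.
  (* The prefix includes position [p], which counts as an [i.+2] but not as an [i.+1]; this makes
     the inequality strict. *)
  have := lattice_count i p.+1 lat.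
  have -> : [seq q <- positions w i.+1 | q < p.+1] = [seq q <- prev | q < p].
    apply: eq_in_filter => q; rewrite mem_positions ltnS leq_eqVlt.
    move=> /eqP wq; case: eqVneq => // e; move: wq.
    by rewrite e wp => /eqP; rewrite eqn_leq ltnn.
  move=> le_lat; apply: leq_trans le_lat.
  apply: (@uniq_leq_size _ (p :: cur)).
    by rewrite /= mem_positions_lt ltnn positions_lt_uniq.
  move=> r; rewrite inE !mem_positions_lt ltnS.
  case: eqVneq => [->|_ /= /andP[lt_rp ->]]; first by rewrite leqnn wp eqxx.
  by rewrite ltnW.
case=> q /andP[+ /andP[lt_qp notin]]; rewrite mem_positions => /eqP wq ->; split.
  by exists q.
move=> r lt_rp wr e; case/negP: notin; rewrite -e map_f //.
by rewrite mem_positions_lt lt_rp wr eqxx.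
Qed.

Lemma label_inj (w : seq nat) (i : nat) : lattice_word w ->
  {in positions w i.+1 &, injective (label w)}.
Proof.
move=> lat; elim: i => [|i IH]; first exact: label1_inj.
move=> p q; rewrite !mem_positions => /eqP wp /eqP wq e.
case: (ltngtP p q) => // lt.
- by have [_ /(_ p lt wp e)] := label_prev lat IH wq.
- by have [_ /(_ q lt wq (esym e))] := label_prev lat IH wp.
Qed.

(** The triple condition in terms of words: a label of an earlier [i.+1] that exceeds the maximum of
    A_k is not in A_k, so an earlier [i.+2] has taken it. *)
Lemma label_max (w : seq nat) (i p q : nat) :
    nth 0 w p = i.+2 -> nth 0 w q = i.+1 -> q < p -> label w p < label w q ->
  exists r, [/\ r < p, nth 0 w r = i.+2 & label w r = label w q].
Proof.
move=> wp wq lt_qp; rewrite (labelS wp) => lt_l.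
set cur := [seq r <- positions w i.+2 | r < p] in lt_l.
have [/mapP[r + e]|notin] := boolP (label w q \in [seq label w r | r <- cur]).
  by rewrite mem_positions_lt => /andP[lt_rp /eqP wr]; exists r.
move: lt_l; rewrite ltnNge => /negP[]; apply: leq_bigmax_seq.
  by rewrite mem_positions wq.
by rewrite lt_qp.
Qed.

(** Iterates [label_prev] down the letters. It makes the rows of cells left-justified and
    increasing. *)
Lemma label_chain (w : seq nat) (i j p : nat) : lattice_word w ->
    nth 0 w p = i.+1 -> j < i ->
  exists q, [/\ q < p, nth 0 w q = j.+1 & label w q = label w p].
Proof.
move=> lat; elim: i p => // i IH p wp; rewrite ltnS leq_eqVlt.
have [[q [lt_qp wq lq]] _] := label_prev lat (@label_inj w i lat) wp.
case: eqVneq => [-> _ | _ /= /(IH q wq)[r [lt_rq wr lr]]]; first by exists q.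
by exists r; rewrite lr lq (ltn_trans lt_rq).
Qed.

(** Every label is inherited from a letter 1, where it is a rank among the 1's. *)
Lemma label_bounds (w : seq nat) (i p : nat) : lattice_word w ->
  nth 0 w p = i.+1 -> 0 < label w p <= count_mem 1 w.
Proof.
move=> lat wp.
have [q wq <-] : exists2 q, nth 0 w q = 1 & label w q = label w p.
  case: i wp => [|i] wp; first by exists p.
  by have [q [_ ? ?]] := label_chain lat wp (ltn0Sn i); exists q.
rewrite label1 //= -size_positions.
apply: (@uniq_leq_size _ (q :: [seq r <- positions w 1 | r < q])).
  by rewrite /= mem_positions_lt ltnn positions_lt_uniq.
move=> r; rewrite inE mem_positions_lt mem_positions.
by case: eqVneq => [->|_ /andP[]//]; rewrite wq.
Qed.

(** * The diagram, its rows and first column, and its boxes *)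

Lemma mem_diagram (alpha : seq nat) (i j : nat) :
  ((i, j) \in diagram alpha) = (1 <= j <= size alpha) && (1 <= i <= part alpha j).
Proof.
apply/allpairsPdep/andP => [[y [x [+ + [-> ->]]]] | [j_in i_in]].
  by rewrite !mem_iota !add1n !ltnS.
by exists j, i; rewrite !mem_iota !add1n !ltnS.
Qed.

Lemma diagram_uniq (alpha : seq nat) : uniq (diagram alpha).
Proof.
apply: allpairs_uniq_dep => [|j _|[j i] [j' i'] _ _ /= [-> ->]] //; exact: iota_uniq.
Qed.

Lemma size_diagram (alpha : seq nat) : size (diagram alpha) = sumn alpha.
Proof.
rewrite size_allpairs_dep; congr sumn; apply: (@eq_from_nth _ 0).
  by rewrite size_map size_iota.
move=> k; rewrite size_map size_iota => lt_k.
by rewrite (nth_map 0) ?size_iota // nth_iota // size_iota /part add1n.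
Qed.

Lemma count_row (alpha : seq nat) (j : nat) : 1 <= j <= size alpha ->
  count (fun b => b.2 == j) (diagram alpha) = part alpha j.
Proof.
move=> j_in; rewrite -size_filter.
transitivity (size [seq (i, j) | i <- iota 1 (part alpha j)]); last first.
  by rewrite size_map size_iota.
apply/perm_size/uniq_perm.
- exact/filter_uniq/diagram_uniq.
- by rewrite map_inj_uniq ?iota_uniq // => i i' [].
move=> [i j']; rewrite mem_filter mem_diagram /=.
apply/andP/mapP => [[/eqP-> /andP[_ i_in]] | [i' + [-> ->]]].
  by exists i; rewrite ?mem_iota ?add1n ?ltnS.
by rewrite mem_iota add1n ltnS eqxx j_in.
Qed.

Lemma part_gt0 (alpha : seq nat) (j : nat) :
  0 \notin alpha -> 1 <= j <= size alpha -> 0 < part alpha j.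
Proof.
move=> alpha0 /andP[j_gt0 le_j]; rewrite lt0n; apply: contraNneq alpha0 => <-.
by apply: mem_nth; rewrite prednK.
Qed.

Lemma part_le_max (alpha : seq nat) (j : nat) : part alpha j <= max_part alpha.
Proof.
rewrite /part; case: (ltnP j.-1 (size alpha)) => [lt_j | ge_j].
  exact/(leq_bigmax_seq (F := id))/isT/mem_nth.
by rewrite nth_default.
Qed.

(** Since no part is 0, every row has exactly one box in column 1. *)
Lemma column_count1 (alpha : seq nat) :
  0 \notin alpha -> column_count alpha 1 = size alpha.
Proof.
move=> alpha0; rewrite /column_count -size_filter.
transitivity (size [seq (1, j) | j <- iota 1 (size alpha)]); last first.
  by rewrite size_map size_iota.
apply/perm_size/uniq_perm.
- exact/filter_uniq/diagram_uniq.
- by rewrite map_inj_uniq ?iota_uniq // => i i' [].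
move=> [i j]; rewrite mem_filter mem_diagram /=.
apply/andP/mapP => [[/eqP-> /andP[j_in _]] | [j' + [-> ->]]].
  by exists j; rewrite ?mem_iota ?add1n ?ltnS.
by rewrite mem_iota add1n ltnS eqxx => j_in; rewrite j_in part_gt0.
Qed.

Lemma perm_ssval_enum (alpha : seq nat) :
  perm_eq [seq ssval b | b <- enum (box alpha)] (diagram alpha).
Proof.
apply: uniq_perm; last move=> x.
- by rewrite map_inj_uniq ?enum_uniq //; apply: val_inj.
- exact: diagram_uniq.
apply/mapP/idP => [[b _ ->] | x_in]; first exact: ssvalP.
by exists (SeqSub x_in : box alpha); rewrite ?mem_enum.
Qed.

Lemma box_exists (alpha : seq nat) (i j : nat) : (i, j) \in diagram alpha ->
  exists b : box alpha, box_col b = i /\ box_row b = j.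
Proof. by move=> ij_in; exists (SeqSub ij_in : box alpha). Qed.

Lemma box_inj (alpha : seq nat) (b c : box alpha) :
  box_col b = box_col c -> box_row b = box_row c -> b = c.
Proof.
move=> e1 e2; apply: val_inj; rewrite [val b]surjective_pairing /=.
by rewrite [RHS]surjective_pairing; congr pair.
Qed.

Lemma box_in (alpha : seq nat) (b : box alpha) :
  (1 <= box_row b <= size alpha) && (1 <= box_col b <= part alpha (box_row b)).
Proof.
rewrite -mem_diagram /box_col /box_row -surjective_pairing; exact: ssvalP.
Qed.

(** * Column words of standard fillings *)

Section StandardFilling.
Variables (alpha : seq nat) (T : filling alpha).
Hypothesis T_std : perm_eq (codom T) (iota 1 (sumn alpha)).

Lemma filling_inj : injective T.
Proof.
apply/injectiveP; rewrite /injectiveb /dinjectiveb (perm_uniq T_std).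
exact: iota_uniq.
Qed.

Lemma filling_gt0 (b : box alpha) : 0 < T b <= sumn alpha.
Proof.
have := codom_f T b; rewrite (perm_mem T_std) mem_iota add1n ltnS //.
Qed.

Lemma filling_surj (m : nat) : 0 < m <= sumn alpha -> exists b, T b = m.
Proof.
move=> m_in; have : m \in codom T by rewrite (perm_mem T_std) mem_iota add1n ltnS.
by case/codomP => b ->; exists b.
Qed.

Lemma column_ofE (b : box alpha) : column_of T (T b) = box_col b.
Proof.
rewrite /column_of; case: pickP => [c /eqP/filling_inj-> // | /(_ b)].
by rewrite eqxx.
Qed.

Let w := column_word alpha T.

(** Entries start at 1 and positions at 0, hence the predecessor. *)
Lemma nth_column_word (b : box alpha) : nth 0 w (T b).-1 = box_col b.
Proof.
have /andP[T_gt0 T_le] := filling_gt0 b.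
rewrite (nth_map 0) ?size_iota ?prednK // nth_iota ?prednK //.
by rewrite add1n prednK // column_ofE.
Qed.

Lemma column_word_box (i p : nat) : nth 0 w p = i.+1 ->
  exists2 b, T b = p.+1 & box_col b = i.+1.
Proof.
move=> wp; have lt_p : p < sumn alpha.
  case: ltnP => // le_p; rewrite nth_default // in wp.
  by rewrite size_map size_iota.
have [|b Tb] := @filling_surj p.+1; first by [].
by exists b => //; rewrite -nth_column_word Tb.
Qed.

(** The values of [T] rearrange 1, ..., n, so the column word rearranges the columns of the
    boxes. *)
Lemma perm_column_word : perm_eq w [seq x.1 | x <- diagram alpha].
Proof.
have := perm_map (column_of T) T_std; rewrite perm_sym => /perm_trans; apply.
rewrite -map_comp (eq_map column_ofE).
by have := perm_map fst (perm_ssval_enum alpha); rewrite -map_comp.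
Qed.

Lemma perm_rs_column_word :
    (forall b, label w (T b).-1 = box_row b) ->
  perm_eq (rs w) [seq x.2 | x <- diagram alpha].
Proof.
move=> labE; have -> : rs w = [seq label w m.-1 | m <- iota 1 (sumn alpha)].
  rewrite -[LHS](mkseq_nth 0) size_rs size_map size_iota (iotaDl 1 0) -map_comp.
  exact: eq_map.
have := perm_map (fun m => label w m.-1) T_std; rewrite perm_sym => /perm_trans.
apply; rewrite -map_comp (eq_map labE).
by have := perm_map snd (perm_ssval_enum alpha); rewrite -map_comp.
Qed.

End StandardFilling.

(** * Tableaux have column words in [W_SYCT] and are determined by them *)

Section Tableau.
Variables (alpha : seq nat) (T : filling alpha).
Hypotheses (alpha0 : 0 \notin alpha) (T_SYCT : SYCT alpha T).

Let w := column_word alpha T.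
Let T_std : perm_eq (codom T) (iota 1 (sumn alpha)).
Proof. by case: T_SYCT. Qed.

Let Tpred (b : box alpha) : (T b).-1.+1 = T b.
Proof. by rewrite prednK //; case/andP: (filling_gt0 T_std b). Qed.

Lemma box_left (b : box alpha) (i : nat) : box_col b = i.+2 ->
  exists c, [/\ box_col c = i.+1, box_row c = box_row b & T c < T b].
Proof.
move=> bi; have [|c [ci cj]] := @box_exists alpha i.+1 (box_row b).
  have /andP[row_in /andP[_ col_in]] := box_in b.
  by rewrite mem_diagram row_in /= ltnW // -bi.
by exists c; split=> //; case: T_SYCT => _ + _ _; apply; rewrite // ci bi.
Qed.

(** Strong induction on the entry: its label depends only on labels at earlier positions, which
    belong to smaller entries. *)
Lemma label_column_word (b : box alpha) : label w (T b).-1 = box_row b.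
Proof.
have [m] := ubnP (T b); elim: m b => // m IH b; rewrite ltnS => le_m.
have {}IH c : T c < T b -> label w (T c).-1 = box_row c.
  by move=> lt_c; apply: IH; apply: leq_trans le_m.
have wb := nth_column_word T_std b; rewrite -/w in wb.
have [_ _ first_col triple] := T_SYCT.
case bi: (box_col b) wb => [|[|i]] wb.
- by have := box_in b; rewrite bi !andbF.
- rewrite label1 //; have /andP[/andP[row_gt0 row_le] _] := box_in b.
  (* In column 1 the label counts smaller entries of that column; these occupy exactly the rows
     below [b]. *)
  rewrite -[RHS](prednK row_gt0) -[X in _ = X.+1](size_iota 1) -(size_map (label w)).
  congr _.+1; apply/perm_size/uniq_perm.
  + rewrite map_inj_in_uniq ?positions_lt_uniq // => p q.
    rewrite !mem_positions_lt -!mem_positions => /andP[_ ?] /andP[_ ?].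
    exact: label1_inj.
  + exact: iota_uniq.
  move=> j; rewrite mem_iota add1n prednK //; apply/mapP/andP => [[p]|[j_gt0 lt_j]].
    rewrite mem_positions_lt => /andP[lt_p /eqP/(column_word_box T_std)[c Tc ci]] ->.
    have lt_c : T c < T b by rewrite Tc -Tpred ltnS.
    have <- : (T c).-1 = p by rewrite Tc.
    rewrite IH //; have /andP[/andP[-> _] _] := box_in c; split=> //.
    case: ltngtP => // [|e].
      by move/(first_col _ _ bi ci); rewrite ltnNge (ltnW lt_c).
    by rewrite (@box_inj _ c b) ?ci ?ltnn in lt_c.
  have j_in : 1 <= j <= size alpha by rewrite j_gt0 (leq_trans (ltnW lt_j)).
  have [|c [ci cj]] := @box_exists alpha 1 j.
    by rewrite mem_diagram j_in part_gt0.
  have lt_c : T c < T b by apply: first_col; rewrite ?cj.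
  exists (T c).-1; last by rewrite IH.
  by rewrite mem_positions_lt -ltnS !Tpred lt_c (nth_column_word T_std) ci.
- have [c [ci cj lt_c]] := box_left bi.
  rewrite (labelS wb); apply/eqP; rewrite eqn_leq; apply/andP; split.
    (* Upper bound: a candidate in a row above [b] would, by the triple condition, have a right
       neighbour smaller than [T b], so its row would already be used. *)
    apply/bigmax_leqP_seq => p; rewrite mem_positions.
    move=> /eqP/(column_word_box T_std)[d Td di] /andP[lt_p notin].
    have lt_d : T d < T b by rewrite Td -Tpred ltnS.
    have Ed : (T d).-1 = p by rewrite Td.
    rewrite -Ed IH //; rewrite leqNgt; apply/negP => lt_bd.
    have [|e [ei ej lt_e]] := triple d b lt_bd _ (ltnW lt_d); first by rewrite di.
    case/negP: notin; rewrite -Ed IH // -ej -IH // map_f //.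
    by rewrite mem_positions_lt -ltnS !Tpred lt_e (nth_column_word T_std) ei di eqxx.
  rewrite -cj -IH //; apply: leq_bigmax_seq.
    by rewrite mem_positions (nth_column_word T_std) ci.
  rewrite -ltnS !Tpred lt_c IH //=; apply/mapP => -[p].
  rewrite mem_positions_lt => /andP[lt_p /eqP/(column_word_box T_std)[d Td di]].
  have lt_d : T d < T b by rewrite Td -Tpred ltnS.
  have <- : (T d).-1 = p by rewrite Td.
  rewrite IH // cj => e; move: lt_d.
  by rewrite (@box_inj _ d b) ?di ?ltnn.
Qed.

(** Each entry of column [i.+2] in a prefix has its smaller left neighbour in the same prefix, so
    the rows met in column [i.+2] are among those met in column [i.+1]. Labels stand for rows in the
    count. *)
Lemma column_word_lattice : lattice_word w.
Proof.
split=> [x|u /prefixP[v w_uv] [//|i] _].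
  rewrite (perm_mem (perm_column_word T_std)) => /mapP[[c j] + ->].
  by rewrite mem_diagram => /andP[_ /andP[]].
have -> : u = take (size u) w by rewrite w_uv take_size_cat.
rewrite !count_mem_take -(size_map (label w)) -[leqRHS](size_map (label w)).
apply: uniq_leq_size => [|_ /mapP[p + ->]].
  rewrite map_inj_in_uniq ?positions_lt_uniq // => p q.
  rewrite !mem_positions_lt.
  move=> /andP[_ /eqP/(column_word_box T_std)[b Tb bi]].
  move=> /andP[_ /eqP/(column_word_box T_std)[c Tc ci]].
  have [<- <-] : (T b).-1 = p /\ (T c).-1 = q by rewrite Tb Tc.
  by rewrite !label_column_word => e; rewrite (@box_inj _ b c) ?bi ?ci.
rewrite mem_positions_lt => /andP[lt_p /eqP/(column_word_box T_std)[b Tb bi]].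
have [c [ci cj lt_c]] := box_left bi.
have <- : (T b).-1 = p by rewrite Tb.
rewrite label_column_word -cj -label_column_word map_f //.
rewrite mem_positions_lt (nth_column_word T_std) ci eqxx andbT.
by apply: leq_trans lt_p; rewrite Tpred -Tb ltnW.
Qed.

Lemma column_word_W : W_SYCT alpha w.
Proof.
split; first exact: column_word_lattice.
- move=> x; rewrite (perm_mem (perm_column_word T_std)) => /mapP[[c j] + ->] /=.
  rewrite mem_diagram => /andP[_ /andP[-> /leq_trans]]; apply; exact: part_le_max.
- by move=> i _; rewrite (permP (perm_column_word T_std)) count_map.
move=> j j_in; rewrite (permP (perm_rs_column_word T_std label_column_word)).
by rewrite count_map -count_row.
Qed.

End Tableau.

(** [rs] depends on the word alone, so the position of an entry yields its column and its row in
    both tableaux. *)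
Lemma column_word_inj (alpha : seq nat) (T U : filling alpha) :
    0 \notin alpha -> SYCT alpha T -> SYCT alpha U ->
  column_word alpha T = column_word alpha U -> T = U.
Proof.
move=> alpha0 hT hU e; apply/ffunP => b.
have [stdT _ _ _] := hT; have [stdU _ _ _] := hU.
have := nth_column_word stdT b; have /andP[/andP[_ _] /andP[]] := box_in b.
case bi: (box_col b) => [//|i] _ _; rewrite e => /(column_word_box stdU)[c Uc ci].
have eTU : T b = U c.
  by rewrite Uc prednK //; case/andP: (filling_gt0 stdT b).
rewrite eTU; congr (U _); apply/esym/box_inj; rewrite ?bi ?ci //.
rewrite -(label_column_word alpha0 hT).
by rewrite e eTU label_column_word.
Qed.

(** * The inverse map, from words to tableaux *)

Section Cells.
Variables (alpha w : seq nat).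
Hypotheses (alpha0 : 0 \notin alpha) (w_W : W_SYCT alpha w).

Let cells := zip w (rs w).

Let lat : lattice_word w.
Proof. by case: w_W. Qed.

Lemma size_cells : size cells = size w.
Proof. by rewrite size1_zip ?size_rs. Qed.

Lemma nth_cells (p : nat) : nth (0, 0) cells p = (nth 0 w p, label w p).
Proof. by rewrite nth_zip ?size_rs. Qed.

Lemma mem_cellsP (i j : nat) :
  reflect (exists2 p, nth 0 w p = i.+1 & label w p = j) ((i.+1, j) \in cells).
Proof.
apply: (iffP (nthP (0, 0))) => [[p _] | [p wp <-]].
  by rewrite nth_cells => -[wp lp]; exists p.
exists p; last by rewrite nth_cells wp.
by rewrite size_cells; case: ltnP => // le_p; rewrite nth_default in wp.
Qed.

Lemma cells_gt0 (x : nat * nat) : x \in cells -> 0 < x.1.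
Proof.
case/(nthP (0, 0)) => p; rewrite size_cells => lt_p <-; rewrite nth_cells /=.
by have [+ _] := lat; apply; apply: mem_nth.
Qed.

Lemma cells_uniq : uniq cells.
Proof.
apply/(uniqP (0, 0)) => p q p_in q_in; have := cells_gt0 (mem_nth (0, 0) p_in).
rewrite !nth_cells /=; case wp: (nth 0 w p) => [//|i] _ [wq].
by apply: (@label_inj w i lat); rewrite mem_positions ?wp -?wq.
Qed.

Lemma cells_left (i k j : nat) :
  (i.+1, j) \in cells -> k <= i -> (k.+1, j) \in cells.
Proof.
move=> ij_in; rewrite leq_eqVlt => /predU1P[-> // | lt_ki].
case/mem_cellsP: ij_in => p wp lp; apply/mem_cellsP.
by have [q [_ wq lq]] := label_chain lat wp lt_ki; exists q; rewrite ?lq.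
Qed.

Lemma count_cells_row (j : nat) : 1 <= j <= size alpha ->
  size [seq x <- cells | x.2 == j] = part alpha j.
Proof.
case: w_W => _ _ _ rows /rows <-; rewrite size_filter.
by rewrite -[in RHS](@unzip2_zip _ _ w (rs w)) ?size_rs // count_map.
Qed.

(** The label is at most the number of 1's, which is the number of rows. Left-justification puts
    [i.+1] distinct cells in row [j], which has only [part alpha j] of them. *)
Lemma cells_diagram (x : nat * nat) : x \in cells -> x \in diagram alpha.
Proof.
move=> x_in; have := cells_gt0 x_in; case: x x_in => [[//|i] j] ij_in _.
have [p wp lp] := mem_cellsP i j ij_in.
have [_ letters cols _] := w_W.
have j_in : 1 <= j <= size alpha.
  rewrite -column_count1 // -cols -?lp; first exact: label_bounds wp.
  (* Using [cols] at 1 requires a positive [max_part alpha]; the letter [i.+1] occurring in [w]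
     provides it. *)
  have/letters/andP[_] : i.+1 \in w.
    by rewrite -wp mem_nth //; case: ltnP => // le_p; rewrite nth_default in wp.
  exact: leq_trans.
rewrite mem_diagram j_in -count_cells_row //=.
rewrite -(size_iota 0 i.+1) -(size_map (fun k => (k.+1, j))).
apply: uniq_leq_size.
  by rewrite map_inj_uniq ?iota_uniq // => k l [].
move=> _ /mapP[k + ->]; rewrite mem_iota add0n /= ltnS => le_k.
by rewrite mem_filter eqxx (cells_left ij_in).
Qed.

(** The cells of row [j] are distinct boxes of that row and as many as it has, so the inclusion is
    an equality. *)
Lemma perm_cells : perm_eq cells (diagram alpha).
Proof.
apply: uniq_perm cells_uniq (diagram_uniq alpha) _ => -[i j].
apply/idP/idP; first exact: cells_diagram.
rewrite mem_diagram => /andP[j_in i_in].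
have [] := @uniq_min_size _ [seq x <- cells | x.2 == j]
                            [seq (k, j) | k <- iota 1 (part alpha j)].
- exact/filter_uniq/cells_uniq.
- move=> [k l]; rewrite mem_filter /= => /andP[/eqP->] /cells_diagram.
  rewrite mem_diagram => /andP[_ k_in].
  by rewrite map_f // mem_iota add1n ltnS.
- by rewrite size_map size_iota count_cells_row.
move=> _ /(_ (i, j)); rewrite mem_filter eqxx /= => ->.
by rewrite map_f // mem_iota add1n ltnS.
Qed.

(** The cell at position [p] receives the entry [p.+1]; [box_in_cells] shows that every box is such
    a cell. *)
Definition cell_filling : filling alpha :=
  [ffun b => (index (ssval b) cells).+1].

Lemma box_in_cells (b : box alpha) : ssval b \in cells.
Proof. by rewrite (perm_mem perm_cells) ssvalP. Qed.

Lemma cell_filling_nth (b : box alpha) :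
  exists p, [/\ cell_filling b = p.+1, nth 0 w p = box_col b
               & label w p = box_row b].
Proof.
exists (index (ssval b) cells); rewrite ffunE /box_col /box_row.
have := nth_index (0, 0) (box_in_cells b); rewrite nth_cells => e.
by rewrite -[in (ssval b).1]e -[in (ssval b).2]e.
Qed.

(** A positive letter and a label determine the position, by [label_inj]. *)
Lemma cell_filling_eq (b : box alpha) (p : nat) : 0 < box_col b ->
  nth 0 w p = box_col b -> label w p = box_row b -> cell_filling b = p.+1.
Proof.
have [q [-> <- <-]] := cell_filling_nth b.
case wq: (nth 0 w q) => [//|i] _ wp e; congr _.+1.
by apply: (@label_inj w i lat); rewrite ?mem_positions ?wp ?wq.
Qed.

Lemma cell_filling_std : perm_eq (codom cell_filling) (iota 1 (sumn alpha)).
Proof.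
have -> : codom cell_filling =
    [seq (index x cells).+1 | x <- [seq ssval b | b <- enum (box alpha)]].
  by rewrite -map_comp; apply: eq_map => b; rewrite /= ffunE.
apply: (@perm_trans _ [seq (index x cells).+1 | x <- cells]).
  apply: perm_map; apply: perm_trans (perm_ssval_enum alpha) _.
  by rewrite perm_sym perm_cells.
suff -> : [seq (index x cells).+1 | x <- cells] = iota 1 (sumn alpha) by [].
rewrite -size_diagram -(perm_size perm_cells).
apply: (@eq_from_nth _ 0) => [|p]; rewrite size_map ?size_iota // => lt_p.
by rewrite (nth_map (0, 0)) // nth_iota // index_uniq // cells_uniq.
Qed.

Lemma cell_filling_SYCT : SYCT alpha cell_filling.
Proof.
split; first exact: cell_filling_std.
- move=> b c e_row lt_col; have := box_in b; have := box_in c.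
  have [p [-> wp lp]] := cell_filling_nth c.
  case ci: (box_col c) wp lt_col => [|i] // wp.
  case bi: (box_col b) => [|k]; first by rewrite andbF.
  (* The label of [c] comes from an earlier letter [k.+1], whose position is that of [b]. *)
  rewrite ltnS => /(label_chain lat wp)[q [lt_qp wq lq]] _ _.
  by rewrite (@cell_filling_eq b q) ?bi // lq lp.
- move=> b c; have [p [-> wp lp]] := cell_filling_nth b.
  have [q [-> wq lq]] := cell_filling_nth c.
  move=> bi ci; rewrite bi in wp; rewrite ci in wq.
  (* A 1 at [q <= p] would have no more 1's before it than the one at [p], against its larger
     label. *)
  rewrite -lp -lq !label1 // !ltnS => lt_l; rewrite ltnNge; apply/negP => le_qp.
  move: lt_l; rewrite ltnNge => /negP[]; apply: uniq_leq_size.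
    exact: positions_lt_uniq.
  move=> r; rewrite !mem_positions_lt => /andP[lt_r ->].
  by rewrite (leq_trans lt_r).
move=> b c lt_row e_col; have /andP[row_b /andP[b_gt0 _]] := box_in b.
have [p [eb wp lp]] := cell_filling_nth b.
have [q [ec wq lq]] := cell_filling_nth c.
case bi: (box_col b) b_gt0 wp e_col => [//|i] _ wp ci.
rewrite ci in wq; rewrite eb ec ltnS leq_eqVlt.
(* Equality would give one position two different letters. *)
case: eqVneq => [e|_ /= lt_pq]; first by move: wq; rewrite -e wp => -[/n_Sn].
(* Maximality supplies an earlier [i.+2] with the label of [b]: the box to the right of [b]. *)
have [|r [lt_rq wr lr]] := label_max wq wp lt_pq; first by rewrite lp lq.
have [|d [di dj]] := @box_exists alpha i.+2 (box_row b).
  by apply: cells_diagram; apply/mem_cellsP; exists r; rewrite ?lr.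
exists d; split=> //.
by rewrite (@cell_filling_eq d r) ?di ?dj ?lr.
Qed.

Lemma cell_fillingK : column_word alpha cell_filling = w.
Proof.
have sz : size w = sumn alpha.
  by rewrite -size_cells (perm_size perm_cells) size_diagram.
apply: (@eq_from_nth _ 0); first by rewrite size_map size_iota sz.
move=> p; rewrite size_map size_iota => lt_p.
have [|b eb] := filling_surj cell_filling_std (m := p.+1); first by [].
have [q [+ wq _]] := cell_filling_nth b; rewrite eb => -[pq].
by have := nth_column_word cell_filling_std b; rewrite eb -wq -pq.
Qed.

End Cells.

Theorem proposition5p3 (n : nat) (alpha : seq nat)
    (alpha_comp : composition n alpha) :
  set_bij (SYCT alpha) (W_SYCT alpha) (column_word alpha).
Proof.
have [alpha0 _] := alpha_comp; split.
- by move=> T hT; apply: column_word_W.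
- by move=> T U; rewrite !inE; apply: column_word_inj.
move=> w w_W; exists (cell_filling alpha w); first exact: cell_filling_SYCT.
exact: cell_fillingK.
Qed.
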